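(* Let $\Delta t>0$ and define the composition $$\text{Scheme-5}(\Delta t):=\text{Scheme-a}(\Delta t/2)\,\text{Scheme-b}(\Delta t/2)\,\text{Scheme-c}(\Delta t)\,\text{Scheme-b}(\Delta t/2)\,\text{Scheme-a}(\Delta t/2),$$ where Scheme-a, Scheme-b, Scheme-c are the one-step maps described in the context. If $(f^{n+1},\mathbf{E}^{n+1},\mathbf{B}^{n+1})$ is obtained from $(f^n,\mathbf{E}^n,\mathbf{B}^n)$ by Scheme-5$(\Delta t)$, then $TE_n=TE_{n+1}$, where $$2\,TE_n=\int_{\Omega_x}\int_{\Omega_v} f^n|\mathbf{v}|^2\,d\mathbf{v}\,d\mathbf{x}+\int_{\Omega_x}\big(|\mathbf{E}^n|^2+|\mathbf{B}^n|^2\big)\,d\mathbf{x}.$$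
   Context: Setting. $\Omega_x\subset\mathbb{R}^3$ is a box with periodic boundary conditions and $\Omega_v\subset\mathbb{R}^3$ is a bounded velocity domain. The unknowns are $f=f(\mathbf{x},\mathbf{v})$ on $\Omega_x\times\Omega_v$ (scalar) and $\mathbf{E}(\mathbf{x}),\mathbf{B}(\mathbf{x})\in\mathbb{R}^3$ on $\Omega_x$. All functions are smooth enough for the expressions below to make sense, periodic in $\mathbf{x}$, and all $f$'s (including those at intermediate substeps) vanish on $\partial\Omega_v$. For any time index $s$, $\mathbf{J}^s(\mathbf{x})=\int_{\Omega_v}f^s(\mathbf{x},\mathbf{v})\,\mathbf{v}\,d\mathbf{v}$. Each of the following maps a state $(f^n,\mathbf{E}^n,\mathbf{B}^n)$ to a state $(f^{n+1},\mathbf{E}^{n+1},\mathbf{B}^{n+1})$ (here $n,n+1$ label the beginning and end of the substep, and for the implicit equations the new state is any solution), with step size $\tau$. Scheme-a$(\tau)$: $\frac{f^{n+1}-f^n}{\tau}+\mathbf{v}\cdot\nabla_{\mathbf{x}}\frac{f^n+f^{n+1}}{2}=0$, $\mathbf{E}^{n+1}=\mathbf{E}^n$, $\mathbf{B}^{n+1}=\mathbf{B}^n$. Scheme-b$(\tau)$: $\frac{f^{n+1}-f^n}{\tau}+\tfrac12(\mathbf{E}^n+\mathbf{E}^{n+1})\cdot\nabla_{\mathbf{v}}\frac{f^n+f^{n+1}}{2}=0$, $\frac{\mathbf{E}^{n+1}-\mathbf{E}^n}{\tau}=-\tfrac12(\mathbf{J}^n+\mathbf{J}^{n+1})$, $\mathbf{B}^{n+1}=\mathbf{B}^n$.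 Scheme-c$(\tau)$: $\frac{\mathbf{B}^{n+1}-\mathbf{B}^n}{\tau}=-\nabla_{\mathbf{x}}\times\frac{\mathbf{E}^n+\mathbf{E}^{n+1}}{2}$, $\frac{\mathbf{E}^{n+1}-\mathbf{E}^n}{\tau}=\nabla_{\mathbf{x}}\times\frac{\mathbf{B}^n+\mathbf{B}^{n+1}}{2}$, $\frac{f^{n+1}-f^n}{\tau}+\tfrac12\big(\mathbf{v}\times(\mathbf{B}^n+\mathbf{B}^{n+1})\big)\cdot\nabla_{\mathbf{v}}\frac{f^n+f^{n+1}}{2}=0$. Juxtaposition of schemes denotes composition of the maps. *)

(* Defs.v *)
From HB Require Import structures.
From mathcomp Require Import all_boot all_order all_algebra.
From mathcomp Require Import all_classical all_reals all_analysis.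
Set Implicit Arguments.
Unset Strict Implicit.
Unset Printing Implicit Defensive.
Import Order.TTheory GRing.Theory Num.Theory.
Import numFieldNormedType.Exports.
Local Open Scope classical_set_scope.
Local Open Scope ring_scope.

Section VectorCalculus.
Context {R : realType}.
Local Notation V := 'rV[R]_3.

Definition row3 (a b c : R) : V := \row_(i < 3) nth 0 [:: a; b; c] i.

(* The library norm on row vectors is the max norm; the Euclidean |u|^2 is
   [dot u u]. *)
Definition dot (u w : V) : R := \sum_(i < 3) u 0 i * w 0 i.

Definition cross (u w : V) : V :=
  row3 (u 0 1 * w 0 2 - u 0 2 * w 0 1)
       (u 0 2 * w 0 0 - u 0 0 * w 0 2)
       (u 0 0 * w 0 1 - u 0 1 * w 0 0).

Definition unit_vec (i : 'I_3) : V := delta_mx 0 i.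

Definition partial (i : 'I_3) (g : V -> R) (x : V) : R := 'D_(unit_vec i) g x.

Definition grad (g : V -> R) (x : V) : V := \row_(i < 3) partial i g x.

Definition curl (F : V -> V) (x : V) : V :=
  let d i j := partial i (fun y => F y 0 j) x in
  row3 (d 1 2 - d 2 1) (d 2 0 - d 0 2) (d 0 1 - d 1 0).

Definition lebesgue2 :
    {measure set (measurableTypeR R * measurableTypeR R) -> \bar R} :=
  (@lebesgue_measure R \x @lebesgue_measure R)%E.

Definition lebesgue3 :
    {measure set (measurableTypeR R * measurableTypeR R * measurableTypeR R)
       -> \bar R} :=
  (lebesgue2 \x @lebesgue_measure R)%E.

(* The measurable structure lives on the product type R * R * R, the
   topological one on V; the integral is transported along the coordinates. *)
Definition integral3 (A : set V) (g : V -> R) : R :=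
  let vec p := row3 p.1.1 p.1.2 p.2 in
  \int[lebesgue3]_(p in vec @^-1` A) g (vec p).

(* F is of class C^1 up to the boundary of the open set U: differentiable in U,
   and F and its derivatives extend continuously to the closure of U. *)
Definition C1_closure (W Z : normedModType R) (U : set W) (F : W -> Z) : Prop :=
  [/\ {within closure U, continuous F},
      forall p, U p -> differentiable F p
    & forall w, exists2 G : W -> Z,
        {within closure U, continuous G} & forall p, U p -> 'D_w F p = G p].

Definition box (a b : V) : set V :=
  [set x | forall i, a 0 i <= x 0 i <= b 0 i].

Definition box_periodic (T : Type) (a b : V) (g : V -> T) : Prop :=
  forall i x, g (x + (b 0 i - a 0 i) *: unit_vec i) = g x.

End VectorCalculus.

Section VlasovMaxwell.
Context {R : realType}.
Local Notation V := 'rV[R]_3.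

(* Functions on the periodic box [box a b] are represented by periodic
   functions on the whole space. Only the values of [dens x v] for v in the
   closure of Ov are meaningful. *)
Record state (a b : V) (Ov : set V) := State {
  dens : V -> V -> R;
  efield : V -> V;
  bfield : V -> V;
  dens_C1 : C1_closure (setT `*` Ov) (fun p : V * V => dens p.1 p.2);
  efield_C1 : C1_closure setT efield;
  bfield_C1 : C1_closure setT bfield;
  dens_periodic : forall v, closure Ov v -> box_periodic a b (dens ^~ v);
  efield_periodic : box_periodic a b efield;
  bfield_periodic : box_periodic a b bfield;
  dens_boundary : forall x v, (closure Ov `\` Ov^°) v -> dens x v = 0 }.

Variables (a b : V) (Ov : set V).
Implicit Types s t : state a b Ov.

Definition current s (x : V) : V :=
  \row_(i < 3) integral3 Ov (fun v => dens s x v * v 0 i).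

Definition gradx_mid s t (x v : V) : V :=
  grad (fun y => (dens s y v + dens t y v) / 2) x.

Definition gradv_mid s t (x v : V) : V :=
  grad (fun w => (dens s x w + dens t x w) / 2) v.

Definition scheme_a (tau : R) : set (state a b Ov * state a b Ov) :=
  [set st | let: (s, t) := st in
    [/\ forall x v, Ov v ->
          (dens t x v - dens s x v) / tau + dot v (gradx_mid s t x v) = 0,
        efield t = efield s
      & bfield t = bfield s]].

Definition scheme_b (tau : R) : set (state a b Ov * state a b Ov) :=
  [set st | let: (s, t) := st in
    [/\ forall x v, Ov v ->
          (dens t x v - dens s x v) / tau
          + dot (2^-1 *: (efield s x + efield t x)) (gradv_mid s t x v) = 0,
        forall x, tau^-1 *: (efield t x - efield s x)
                  = - (2^-1 *: (current s x + current t x))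
      & bfield t = bfield s]].

Definition scheme_c (tau : R) : set (state a b Ov * state a b Ov) :=
  [set st | let: (s, t) := st in
    [/\ forall x, tau^-1 *: (bfield t x - bfield s x)
                  = - curl (fun y => 2^-1 *: (efield s y + efield t y)) x,
        forall x, tau^-1 *: (efield t x - efield s x)
                  = curl (fun y => 2^-1 *: (bfield s y + bfield t y)) x
      & forall x v, Ov v ->
          (dens t x v - dens s x v) / tau
          + dot (2^-1 *: cross v (bfield s x + bfield t x))
                (gradv_mid s t x v) = 0]].

Definition scheme5 (dt : R) : set (state a b Ov * state a b Ov) :=
  (scheme_a (dt / 2) \; scheme_b (dt / 2) \; scheme_c dt
    \; scheme_b (dt / 2) \; scheme_a (dt / 2))%relation.

Definition total_energy s : R :=
  2^-1 * (integral3 (box a b) (fun x =>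
            integral3 Ov (fun v => dens s x v * dot v v))
        + integral3 (box a b) (fun x =>
            dot (efield s x) (efield s x) + dot (bfield s x) (bfield s x))).

End VlasovMaxwell.

(* Main.v *)
Require Import Defs.
From HB Require Import structures.
From mathcomp Require Import all_boot all_order all_algebra.
From mathcomp Require Import all_classical all_reals all_analysis.
From mathcomp Require Import measurable_realfun ring lra.
Set Implicit Arguments.
Unset Strict Implicit.
Unset Printing Implicit Defensive.
Import Order.TTheory GRing.Theory Num.Theory.
Import numFieldNormedType.Exports.
Local Open Scope classical_set_scope.
Local Open Scope ring_scope.

(**
The kinetic energy changes only through the force a = E + v x B, for which
div_v (|v|^2 a f) = |v|^2 a . grad_v f + 2 (v . E) f: the left side integrates to
0 because f vanishes on the boundary of the velocity domain, so in Scheme-b the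
gain is the midpoint work of E on the current, which the midpoint Ampere equation
takes away from |E|^2 pointwise in x, and in Scheme-c there is none. The Maxwell
part of Scheme-c changes |E|^2 + |B|^2 by the divergence of a multiple of the
midpoint Poynting vector E x B, and Scheme-a changes f by an x-divergence at fixed
v; both vanish over a period.

No regularity of the velocity domain is needed for the divergence theorem: on each
line parallel to an axis its slice is a countable disjoint union of open
intervals, at the endpoints of which the function vanishes, and Fubini concludes.
*)

(** * Measurability of continuous functions *)

(* Unlike [borel] below, this property passes to products. *)
Definition borel_map d (T : measurableType d) (X : topologicalType)
    (phi : T -> X) :=
  exists (I : countType) (B : I -> set X),
    (forall i, measurable (phi @^-1` B i)) /\
    forall x N, nbhs x N -> exists2 i, B i x & B i `<=` N.

Lemma borel_map_id (R : realType) :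
  borel_map (fun x : measurableTypeR R => (x : R)).
Proof.
exists (rat * rat)%type, (fun q => `]ratr q.1, ratr q.2[%classic).
split=> [q|x N]; first exact: measurable_itv.
rewrite nbhs_ballP => -[e /= e0 xeN].
have [q] : exists q : rat, x - e < ratr q < x.
  by apply: rat_in_itvoo; lra.
have [r] : exists r : rat, x < ratr r < x + e.
  by apply: rat_in_itvoo; lra.
move=> xr qx; exists (q, r) => /=; first by rewrite in_itv/=; lra.
move=> y /=; rewrite in_itv/= => qyr; apply: xeN.
by rewrite /ball/= ltr_norml; lra.
Qed.

Lemma borel_map_prod d1 d2 (T1 : measurableType d1) (T2 : measurableType d2)
    (X1 X2 : topologicalType) (phi : T1 -> X1) (psi : T2 -> X2) :
  borel_map phi -> borel_map psi ->
  borel_map (fun p : T1 * T2 => (phi p.1, psi p.2)).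
Proof.
move=> [I [B [mB BN]]] [J [C [mC CN]]].
exists (I * J)%type, (fun k => B k.1 `*` C k.2); split=> [k|[x y] N].
  exact: measurableX (mB k.1) (mC k.2).
move=> [[/= P Q] [xP yQ] PQN].
have [i Bi BP] := BN _ _ xP; have [j Cj CQ] := CN _ _ yQ.
by exists (i, j) => // z [/= /BP Pz /CQ Qz]; exact: PQN.
Qed.

(** Each point of [O] lies in some [B i] contained in [O], so [O] is a countable union of such
    sets. *)
Lemma borel_map_open d (T : measurableType d) (X : topologicalType)
    (phi : T -> X) (O : set X) :
  borel_map phi -> open O -> measurable (phi @^-1` O).
Proof.
move=> [I [B [mB BN]]] oO.
rewrite (_ : phi @^-1` O =
    \bigcup_i (if `[< B i `<=` O >] then phi @^-1` B i else set0)).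
  apply: countable_bigcupT_measurable; first exact: countableP.
  by move=> i; case: ifP => _ //; exact: mB.
apply/seteqP; split=> [p Op|p [i _]].
  have [i Bi BO] := BN _ _ (open_nbhs_nbhs (conj oO Op)).
  by exists i => //; rewrite asboolT.
by case: asboolP => // BO /BO.
Qed.

(** Stated through open sets because the target is a topological space without a chosen
    sigma-algebra. *)
Definition borel d (T : measurableType d) (X : topologicalType) (phi : T -> X) :=
  forall O : set X, open O -> measurable (phi @^-1` O).

Lemma borel_comp d (T : measurableType d) (X Y : topologicalType)
    (phi : T -> X) (c : X -> Y) :
  borel_map phi -> continuous c -> borel (c \o phi).
Proof.
by move=> bphi /continuousP cc O /cc; exact: borel_map_open.
Qed.

Lemma borel_closed d (T : measurableType d) (X : topologicalType)
    (phi : T -> X) (K : set X) :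
  borel phi -> closed K -> measurable (phi @^-1` K).
Proof.
move=> bphi /closed_openC/bphi/measurableC.
by rewrite preimage_setC setCK.
Qed.

(** The preimage under [g] of an open interval is, within [K], the trace of an open set [V], and
    [phi] pulls both [V] and [K] back to measurable sets. *)
Lemma borel_within d (T : measurableType d) (X : topologicalType) (R : realType)
    (phi : T -> X) (K : set X) (g : X -> R) :
  borel phi -> closed K -> {within K, continuous g} ->
  measurable_fun (phi @^-1` K) (g \o phi).
Proof.
move=> bphi cK /continuousP cg.
apply: (measurability _ (RGenOpens.measurableE R)).
move=> _ [_ [a [b ->] <-]].
have /open_subspaceP[V oV VD] : open (from_subspace K g @^-1` `]a, b[%classic).
  by apply: cg; exact: interval_open.
rewrite (_ : _ `&` _ = phi @^-1` (V `&` K)).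
  by apply: measurableI; [exact: bphi|exact: borel_closed].
by rewrite VD setIC.
Qed.

Lemma within_continuous_comp (X Y Z : topologicalType) (K : set X) (L : set Y)
    (f : X -> Y) (g : Y -> Z) :
  continuous f -> (forall x, K x -> L (f x)) ->
  {within L, continuous g} -> {within K, continuous (g \o f)}.
Proof.
move=> cf KL /subspace_continuousP cg; apply/subspace_continuousP => x Kx.
move=> W gW; have /cf LW := cg _ (KL _ Kx) _ gW.
rewrite /= in LW *; change (nbhs x [set y | K y -> W (g (f y))]).
have : nbhs x (f @^-1` [set y | L y -> W (g y)]) by exact: LW.
by apply: filterS => y /= LWy /KL/LWy.
Qed.

Lemma pair_continuousl (X Y : topologicalType) (y : Y) :
  continuous (fun x : X => (x, y)).
Proof. by move=> x; exact: (cvg_pair cvg_id (cvg_cst y)). Qed.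

Lemma pair_continuousr (X Y : topologicalType) (x : X) :
  continuous (fun y : Y => (x, y)).
Proof. by move=> y; exact: (cvg_pair (cvg_cst x) cvg_id). Qed.

Lemma closed_setX (X Y : topologicalType) (C : set X) (D : set Y) :
  closed C -> closed D -> closed (C `*` D).
Proof.
move=> cC cD; rewrite (_ : C `*` D = fst @^-1` C `&` snd @^-1` D)//.
apply: closedI.
- by apply: preimage_closed cC => -[x y] _; exact: cvg_fst.
- by apply: preimage_closed cD => -[x y] _; exact: cvg_snd.
Qed.

Lemma closure_setX_subset (X Y : topologicalType) (A : set X) (B : set Y) :
  closure A `*` closure B `<=` closure (A `*` B).
Proof.
move=> [x y] [/= Ax By] N [[P Q] /= [Px Qy] PQN].
have [a [Aa Pa]] := Ax _ Px; have [b [Bb Qb]] := By _ Qy.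
by exists (a, b); split=> //; exact: PQN.
Qed.

(** * Integration over bounded subsets of R^3 *)

Lemma row3E (R : realType) (a b c : R) (i : 'I_3) :
  row3 a b c 0 i = [:: a; b; c]`_i.
Proof. by rewrite mxE. Qed.

Lemma row3_continuous (R : realType) :
  continuous (fun q : R * R * R => row3 q.1.1 q.1.2 q.2).
Proof.
move=> /= [[x y] z]; apply/cvg_ballP => e e0; near=> q.
split=> // i j; rewrite ord1 !row3E.
case: j => -[|[|[|//]]] jlt /=; near: q.
- have : (fst \o fst) q @[q --> (x, y, z)] --> x.
    by apply: cvg_comp cvg_fst cvg_fst.
  by move/cvg_ball; exact.
- have : (snd \o fst) q @[q --> (x, y, z)] --> y.
    by apply: cvg_comp cvg_fst cvg_snd.
  by move/cvg_ball; exact.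
- have : snd q @[q --> (x, y, z)] --> z by exact: cvg_snd.
  by move/cvg_ball; exact.
Unshelve. all: by end_near. Qed.

Lemma ler_coord_norm (R : realType) (v : 'rV[R]_3) i : `|v 0 i| <= `|v|.
Proof.
rewrite [leRHS]/Num.Def.normr/= mx_normrE.
exact: (le_bigmax _ _ (ord0, i)).
Qed.

(** The coordinate map inside [integral3], with the measurable product as source, so that domains of
    integration are preimages under it. *)
Definition vec3 (R : realType)
    (p : measurableTypeR R * measurableTypeR R * measurableTypeR R) : 'rV[R]_3 :=
  row3 p.1.1 p.1.2 p.2.

Lemma borel_map3 (R : realType) : borel_map
  (fun p : measurableTypeR R * measurableTypeR R * measurableTypeR R =>
    (((p.1.1 : R), (p.1.2 : R)), (p.2 : R))).
Proof.
exact: (borel_map_prod (borel_map_prod (borel_map_id R) (borel_map_id R))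
  (borel_map_id R)).
Qed.

Lemma borel_vec3 (R : realType) : borel (@vec3 R).
Proof. exact: (borel_comp (borel_map3 R) (@row3_continuous R)). Qed.

Lemma borel_vec3_pair (R : realType) :
  borel (fun pq : (measurableTypeR R * measurableTypeR R * measurableTypeR R) *
    (measurableTypeR R * measurableTypeR R * measurableTypeR R) =>
    (vec3 pq.1, vec3 pq.2)).
Proof.
apply: (@borel_comp _ _ _ _ _
  (fun z : (R * R * R) * (R * R * R) =>
    (row3 z.1.1.1 z.1.1.2 z.1.2, row3 z.2.1.1 z.2.1.2 z.2.2))
  (borel_map_prod (borel_map3 R) (borel_map3 R))).
move=> [z1 z2].
have c1 : row3 z.1.1.1 z.1.1.2 z.1.2 @[z --> (z1, z2)]
    --> row3 z1.1.1 z1.1.2 z1.2.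
  exact: (@cvg_comp _ _ _ fst (fun q : R * R * R => row3 q.1.1 q.1.2 q.2) _ _ _
    cvg_fst (@row3_continuous R z1)).
have c2 : row3 z.2.1.1 z.2.1.2 z.2.2 @[z --> (z1, z2)]
    --> row3 z2.1.1 z2.1.2 z2.2.
  exact: (@cvg_comp _ _ _ snd (fun q : R * R * R => row3 q.1.1 q.1.2 q.2) _ _ _
    cvg_snd (@row3_continuous R z2)).
exact: (cvg_pair c1 c2).
Qed.

(* The library infers a sigma-finite structure on [\x] only for products of
   subprobabilities, hence this copy. *)
Definition sf_prod d1 d2 (T1 : measurableType d1) (T2 : measurableType d2)
    (R : realType) (m1 : {sigma_finite_measure set T1 -> \bar R})
    (m2 : {sigma_finite_measure set T2 -> \bar R}) :
  set (T1 * T2)%type -> \bar R := (m1 \x m2)%E.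

Section sf_prod_instances.
Context d1 d2 (T1 : measurableType d1) (T2 : measurableType d2) (R : realType).
Variables (m1 : {sigma_finite_measure set T1 -> \bar R})
  (m2 : {sigma_finite_measure set T2 -> \bar R}).

HB.instance Definition _ := Measure.copy (sf_prod m1 m2) (m1 \x m2)%E.

(** Products of two nondecreasing exhaustions by sets of finite measure form an exhaustion: a pair
    is reached at the larger of its two indices. *)
Lemma sf_prod_sigma_finite : sigma_finite setT (sf_prod m1 m2).
Proof.
have /sigma_finiteP[F [TF ndF Foo]] := sigma_finiteT m1.
have /sigma_finiteP[G [TG ndG Goo]] := sigma_finiteT m2.
exists (fun n => F n `*` G n).
  apply/seteqP; split=> // -[x y] _.
  have [n _ Fx] : (\bigcup_i F i) x by rewrite -TF.
  have [m _ Gy] : (\bigcup_i G i) y by rewrite -TG.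
  exists (maxn n m) => //; split.
    by have /subsetPset := ndF _ _ (leq_maxl n m); exact.
  by have /subsetPset := ndG _ _ (leq_maxr n m); exact.
move=> k; have [mF Fk] := Foo k; have [mG Gk] := Goo k.
split; first exact: measurableX.
by rewrite [ltLHS]product_measure1E// lte_mul_pinfty// ge0_fin_numE.
Qed.

HB.instance Definition _ :=
  Measure_isSigmaFinite.Build _ _ _ (sf_prod m1 m2) sf_prod_sigma_finite.

End sf_prod_instances.

Definition leb1 (R : realType) :
  {sigma_finite_measure set (measurableTypeR R) -> \bar R} := lebesgue_measure.

Definition leb2 (R : realType) :
  {sigma_finite_measure set (measurableTypeR R * measurableTypeR R)%type
     -> \bar R} := sf_prod (leb1 R) (leb1 R).

Definition leb3 (R : realType) : {sigma_finite_measure set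
    (measurableTypeR R * measurableTypeR R * measurableTypeR R)%type
     -> \bar R} := sf_prod (leb2 R) (leb1 R).

(** [leb3] unfolds to [lebesgue3], so the sides are convertible; the right one carries the
    sigma-finite structure that Fubini asks for. *)
Lemma integral3E (R : realType) (A : set 'rV[R]_3) (g : 'rV[R]_3 -> R) :
  integral3 A g = \int[leb3 R]_(p in @vec3 R @^-1` A) (g (vec3 p)).
Proof. by []. Qed.

Lemma leb3_bounded (R : realType) (A : set 'rV[R]_3) :
  bounded_set A -> measurable (@vec3 R @^-1` A) ->
  (leb3 R (@vec3 R @^-1` A) < +oo)%E.
Proof.
move=> /pinfty_ex_gt0[M M0 AM] mA.
pose I : set (measurableTypeR R) := `[- M, M]%classic.
have mI : measurable I by exact: measurable_itv.
apply: (@le_lt_trans _ _ (leb3 R ((I `*` I) `*` I))).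
  apply: le_measure; rewrite ?inE//.
    by apply: measurableX => //; exact: measurableX.
  move=> p /AM pM.
  have pi i : `|vec3 p 0 i| <= M by exact: le_trans (ler_coord_norm _ _) pM.
  rewrite /I /= !in_itv/= -!ler_norml.
  move: (pi 0) (pi 1) (pi 2); rewrite /vec3 !row3E/=.
  by rewrite /= => -> -> ->.
rewrite [ltLHS]product_measure1E//=; last exact: measurableX.
rewrite /leb2/= [X in (X * _)%E]product_measure1E//.
rewrite [X in (X * X * X)%E]lebesgue_measure_itv/=.
by case: ifP => _; rewrite ?EFinN -?EFinD -?EFinM ?mule0 ?ltry.
Qed.

Definition integrable3 (R : realType) (A : set 'rV[R]_3) (g : 'rV[R]_3 -> R) :=
  (leb3 R).-integrable (@vec3 R @^-1` A) (fun p => (g (vec3 p))%:E).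

Lemma within_bounded (R : realType) (X : topologicalType) (K A : set X) (g : X -> R) :
  compact K -> A `<=` K -> {within K, continuous g} -> [bounded g x | x in A].
Proof.
move=> cK AK cg; have /compact_bounded[M [Mr HM]] := continuous_compact cg cK.
exists M; split; rewrite ?num_real // => x Mx y Ay /=; apply: HM => //.
by exists y => //; exact: AK.
Qed.

Lemma bounded_closure (R : realType) (A : set 'rV[R]_3) :
  bounded_set A -> compact (closure A).
Proof.
move=> /pinfty_ex_gt0[M M0 AM].
apply: bounded_closed_compact; last exact: closed_closure.
exists M; split=> [|x Mx y]; rewrite ?num_real //= => Ay.
have : closed [set v : 'rV[R]_3 | `|v| <= M].
  apply: (@preimage_closed _ _ (fun v : 'rV[R]_3 => `|v|) [set x | x <= M]) => [v _|].
    exact: norm_continuous.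
  exact: closed_le.
move=> cB; apply: ltW; apply: le_lt_trans Mx.
by move: Ay => /(closure_subset AM); rewrite -((closure_id _).1 cB).
Qed.

(** The closure of [A] is compact, so [g] is bounded on [A], which has finite measure. *)
Lemma integrable3_within (R : realType) (A : set 'rV[R]_3) (g : 'rV[R]_3 -> R) :
  bounded_set A -> measurable (@vec3 R @^-1` A) ->
  {within closure A, continuous g} -> integrable3 A g.
Proof.
move=> bA mA cg; apply: (measurable_bounded_integrable (f := g \o @vec3 R)) => //.
- exact: leb3_bounded.
- apply: (measurable_funS (E := @vec3 R @^-1` closure A)).
  + apply: borel_closed (@closed_closure _ _); exact: borel_vec3.
  + by move=> p /= Ap; exact: subset_closure.
  + exact: borel_within (@borel_vec3 R) (@closed_closure _ _) cg.
- have [M [Mr HM]] := within_bounded (bounded_closure bA) (@subset_closure _ A) cg.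
  by exists M; split=> // x Mx p /= Ap; exact: HM.
Qed.

(** * Fundamental theorem of calculus on open sets *)

Lemma itvcc_closure_itvoo (R : realType) (c d : R) : c < d ->
  `[c, d]%classic `<=` closure `]c, d[%classic.
Proof.
move=> cd x; rewrite /= in_itv/= => /andP[cx xd] B /nbhs_ballP[e /= e0 xeB].
(* The point sought is x moved towards the midpoint of the interval by the fraction t. Any t in ]0,
   1[ puts it strictly inside, and this one keeps the displacement below e. *)
pose t := e / (e + (d - c)).
have t0 : 0 < t by apply: divr_gt0; lra.
have t1 : t < 1 by rewrite ltr_pdivrMr; lra.
have te : t * (d - c) < e.
  by rewrite /t mulrAC ltr_pdivrMr; [nra|lra].
exists (x + t * ((c + d) / 2 - x)); split.
  by rewrite /= in_itv/=; apply/andP; split; nra.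
apply: xeB; rewrite /ball/= ltr_norml; apply/andP; split; nra.
Qed.

Lemma FTC_vanish (R : realType) (g G : R -> R) (c d : R) : c < d ->
  {within `[c, d], continuous g} -> {within `[c, d], continuous G} ->
  (forall u, c < u < d -> is_derive u 1 g (G u)) -> g c = g d ->
  (\int[lebesgue_measure]_(u in `[c, d]) (G u)%:E = 0)%E.
Proof.
move=> cd cg cG dg gcd.
have [_ gc gd] := (continuous_within_itvP _ cd).1 cg.
rewrite (continuous_FTC2 cd cG (F := g)).
- by rewrite gcd subee.
- by split=> // u; rewrite in_itv/= => /dg[].
- by move=> u; rewrite in_itv/= => /dg du; rewrite derive1E derive_val.
Qed.

(** Both endpoints of a component of [U] lie in [K] but outside [U], so [g] vanishes there and the
    fundamental theorem gives 0 on each component. [K] is kept separate from [closure U] because it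
    will be a slice of a closure, which may exceed the closure of the slice. *)
Lemma open_FTC_vanish (R : realType) (U K : set R) (g G : R -> R) :
  open U -> bounded_set U -> closed K -> U `<=` K ->
  {within K, continuous g} -> {within K, continuous G} ->
  (forall u, U u -> is_derive u 1 g (G u)) ->
  (forall u, K u -> ~ U u -> g u = 0) ->
  (\int[lebesgue_measure]_(u in U) (G u)%:E = 0)%E.
Proof.
move=> oU bU cK UK cg cG dg g0.
(* Integrability is what allows the integral to be split over countably many components. It comes
   from continuity of [G] on the compact set [K] cut by [[- M, M]]. *)
have iU : lebesgue_measure.-integrable (U : set (measurableTypeR R)) (EFin \o G).
  have [M M0 UM] := pinfty_ex_gt0 bU.
  apply: (@integrableS _ _ _ lebesgue_measure
    ((K : set (measurableTypeR R)) `&` `[- M, M]%classic)).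
  - by apply: measurableI; [exact: closed_measurable|exact: measurable_itv].
  - exact: open_measurable.
  - move=> u Uu; split; first exact: UK.
    by rewrite /= in_itv/= -ler_norml; exact: UM.
  - apply: continuous_compact_integrable.
    + apply: (subclosed_compact _ (@segment_compact R (- M) M)).
        by apply: closedI => //; exact: interval_closed.
      by move=> ? [].
    + by apply: continuous_subspaceW cG => ? [].
pose I := open_disjoint_itv oU.
have UI : U = \bigcup_k I k by exact: open_disjoint_itv_bigcup.
have oI k : open (I k) by exact: open_disjoint_itv_open.
have tI : trivIset setT I by exact: open_disjoint_itv_trivIset.
rewrite UI integral_bigcup//.
- apply: eseries0 => k _ _.
  have IU : I k `<=` U by rewrite UI; exact: bigcup_sup.
  have [M M0 UM] := pinfty_ex_gt0 bU.
  have lb : has_lbound (I k).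
    by exists (- M) => u /IU/UM; rewrite /= ler_norml => /andP[].
  have ub : has_ubound (I k).
    by exists M => u /IU/UM; rewrite /= ler_norml => /andP[].
  have itvI : is_interval (I k) by exact: open_disjoint_itv_is_interval.
  have := interval_bounded_interior itvI lb ub.
  have /interior_id -> := oI k.
  set c := inf _; set d := sup _ => Icd.
  (* The enumeration of the components may contain empty sets; they are the case d <= c. *)
  have [cd|dc] := ltP c d; last first.
    rewrite (_ : I k = set0) ?integral_set0//.
    rewrite Icd -subset0 => u /= /andP[cu ud].
    by have := lt_le_trans (lt_trans cu ud) dc; rewrite ltxx.
  have Ioo : I k = `]c, d[%classic.
    by rewrite Icd; apply/seteqP; split=> u; rewrite /= in_itv.
  have cdK : `[c, d]%classic `<=` K.
    rewrite ((closure_id K).1 cK); apply: subset_trans (itvcc_closure_itvoo cd) _.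
    by rewrite -Ioo; apply: closure_subset; exact: subset_trans IU UK.
  (* A limit point of [I k] lying in another component [I j] would make the open set [I j] meet
     [I k], against disjointness. *)
  have notU e : closure (I k) e -> ~ I k e -> ~ U e.
    move=> Ie nIe; rewrite UI => -[j _ Ij].
    have jk : j <> k by move=> jk; rewrite jk in Ij.
    have [u [Iu Ju]] := Ie _ (open_nbhs_nbhs (conj (oI j) Ij)).
    by apply: jk; apply: tI => //; exists u.
  have gend e : e = c \/ e = d -> g e = 0.
    move=> ecd; apply: g0.
      by apply: cdK; rewrite /= in_itv/=; case: ecd => ->; rewrite lexx ltW.
    apply: notU.
      rewrite Ioo; apply: itvcc_closure_itvoo => //.
      by rewrite /= in_itv/=; case: ecd => ->; rewrite lexx ltW.
    by rewrite Ioo /= in_itv/=; case: ecd => ->; rewrite ltxx ?andbF.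
  (* Adding the two endpoints, a null set, brings the integral to the closed interval of
     [FTC_vanish]. *)
  rewrite Ioo -(@integral_itv_bndoo _ c d _ true false); last first.
    apply: measurable_int (integrableS _ _ _ iU) => //.
      exact: open_measurable.
    by rewrite -Ioo.
  apply: (@FTC_vanish _ g G c d) => //.
  + exact: continuous_subspaceW cg.
  + exact: continuous_subspaceW cG.
  + move=> u cud; apply: dg; apply: IU; rewrite Ioo/= in_itv/=; exact: cud.
  + by rewrite !gend//; [right|left].
- by move=> k; apply: open_measurable.
- by rewrite -UI.
Qed.

(** * Fubini *)

Section fubini_vanish.
Context d1 d2 (T1 : measurableType d1) (T2 : measurableType d2) (R : realType).
Variables (m1 : {sigma_finite_measure set T1 -> \bar R})
  (m2 : {sigma_finite_measure set T2 -> \bar R}).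
Variable F : T1 * T2 -> \bar R.
Hypothesis iF : (sf_prod m1 m2).-integrable setT F.

Lemma fubini_vanish2 :
  (forall x, \int[m2]_y F (x, y) = 0)%E -> (\int[sf_prod m1 m2]_p F p = 0)%E.
Proof.
move=> F0; have <- := integral12_prod_meas1 iF.
by rewrite /fubini_F; under eq_integral do rewrite F0; rewrite integral0.
Qed.

(** Almost every section is integrable, so only those need a vanishing integral. Handing this
    integrability to the hypothesis allows the lemma to be applied again to a section that is itself
    a function on a product. *)
Lemma fubini_vanish1 :
  (forall y, m1.-integrable setT (fun x => F (x, y)) ->
    \int[m1]_x F (x, y) = 0)%E ->
  (\int[sf_prod m1 m2]_p F p = 0)%E.
Proof.
move=> F0; have <- := integral21_prod_meas1 iF.
rewrite -(integral0 m2 setT); apply: ae_eq_integral => //.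
  exact: measurable_fubini_G iF.
by apply: filterS (ae_integrable2 iF) => y /F0.
Qed.

End fubini_vanish.

Definition line (R : realType) (i : 'I_3) (v : 'rV[R]_3) (u : R) : 'rV[R]_3 :=
  \row_j (if j == i then u else v 0 j).

Lemma integral3_slice (R : realType) (A : set 'rV[R]_3) (g : 'rV[R]_3 -> R)
    (i : 'I_3) :
  measurable (@vec3 R @^-1` A) -> integrable3 A g ->
  (forall v, \int[lebesgue_measure]_(u in line i v @^-1` A)
    (g (line i v u))%:E = 0)%E ->
  integral3 A g = 0.
Proof.
move=> mA ig g0; rewrite integral3E /Rintegral integral_mkcond.
set F := (X in (\int[_]_x X x)%E).
have iF : (leb3 R).-integrable setT F by apply/integrable_restrict; rewrite ?setTI.
(* On an axis-parallel line, the extension by zero integrates to the integral over the slice of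
   [A]. *)
have FE (v : 'rV[R]_3) (f : R -> _) : (forall u, vec3 (f u) = line i v u) ->
    (\int[leb1 R]_u F (f u) = 0)%E.
  move=> fE; rewrite -[RHS](g0 v) [RHS]integral_mkcond.
  apply: eq_integral => u _; rewrite /F !patchE !fE.
  by congr (if _ then _ else _); apply/idP/idP; rewrite !inE/= fE.
suff -> : (\int[leb3 R]_p F p = 0)%E by [].
(* Coordinates are nested as ((x, y), z): direction 0 is the first factor of the first factor,
   direction 1 the second factor of the first, direction 2 the second factor. The entry 0 in each
   [row3] below is a placeholder that [line] overwrites. *)
case: i g0 FE => -[|[|[|//]]] ilt g0 FE.
- apply: fubini_vanish1 => // z iz; apply: fubini_vanish1 => // y _.
  apply: (FE (row3 0 y z)) => u.
  by apply/rowP => j; rewrite !mxE; case: j => -[|[|[|]]].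
- apply: fubini_vanish1 => // z iz; apply: fubini_vanish2 => // x.
  apply: (FE (row3 x 0 z)) => u.
  by apply/rowP => j; rewrite !mxE; case: j => -[|[|[|]]].
- apply: fubini_vanish2 => // -[x y].
  apply: (FE (row3 x y 0)) => u.
  by apply/rowP => j; rewrite !mxE; case: j => -[|[|[|]]].
Qed.

Section iterated.
Variables (R : realType) (A B : set 'rV[R]_3) (g : 'rV[R]_3 * 'rV[R]_3 -> R).
Hypotheses (bA : bounded_set A) (bB : bounded_set B).
Hypotheses (mA : measurable (@vec3 R @^-1` A)) (mB : measurable (@vec3 R @^-1` B)).
Hypothesis cg : {within closure A `*` closure B, continuous g}.

Let AB := (@vec3 R @^-1` A) `*` (@vec3 R @^-1` B).
Let F := (fun pq => (g (vec3 pq.1, vec3 pq.2))%:E) \_ AB.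

Let mAB : measurable AB. Proof. exact: measurableX. Qed.

Let iF : (sf_prod (leb3 R) (leb3 R)).-integrable setT F.
Proof.
apply/integrable_restrict; rewrite ?setTI//.
have cl : closed (closure A `*` closure B).
  by apply: closed_setX; exact: closed_closure.
have ABcl : A `*` B `<=` closure A `*` closure B.
  by move=> [x y] [/= Ax By]; split; exact: subset_closure.
apply: (@measurable_bounded_integrable _ _ _ _
    (fun pq => g (vec3 pq.1, vec3 pq.2))) => //.
- rewrite [ltLHS]product_measure1E//.
  have := leb3_bounded bA mA; have := leb3_bounded bB mB.
  by move=> ? ?; rewrite lte_mul_pinfty// ge0_fin_numE.
- apply: (measurable_funS (E := (fun pq => (@vec3 R pq.1, @vec3 R pq.2)) @^-1`
      (closure A `*` closure B))).
  + exact: borel_closed (@borel_vec3_pair R) cl.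
  + by move=> pq ABpq; exact: ABcl.
  + exact: borel_within (@borel_vec3_pair R) cl cg.
- have cc : compact (closure A `*` closure B).
    by apply: compact_setX; exact: bounded_closure.
  have [M [Mr HM]] := within_bounded cc ABcl cg.
  by exists M; split=> // x Mx pq /= ABpq; exact: HM.
Qed.

Let iB x : A x -> integrable3 B (fun v => g (x, v)).
Proof.
move=> Ax; apply: integrable3_within => //.
apply: (within_continuous_comp (@pair_continuousr _ _ x) _ cg) => v Bv.
by split=> //; exact: subset_closure.
Qed.

Let iA v : B v -> integrable3 A (fun x => g (x, v)).
Proof.
move=> Bv; apply: integrable3_within => //.
apply: (within_continuous_comp (@pair_continuousl _ _ v) _ cg) => x Ax.
by split=> //; exact: subset_closure.
Qed.

(** The inner integral of the extension by zero is again an extension by zero: for p outside the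
    preimage of [A] the whole section vanishes. Fubini on the full space thus speaks about the
    iterated integral over [A] and [B]. *)
Let FB p : (\int[leb3 R]_q F (p, q) = ((fun p =>
  (integral3 B (fun v => g (vec3 p, v)))%:E) \_ (@vec3 R @^-1` A)) p)%E.
Proof.
rewrite patchE; case: ifPn => [/set_mem Ap|nAp].
- rewrite integral3E /Rintegral fineK; last first.
    by apply: integrable_fin_num (iB Ap) => //.
  rewrite [RHS]integral_mkcond; apply: eq_integral => q _.
  rewrite /F !patchE; congr (if _ then _ else _).
  by apply/idP/idP; rewrite !inE => // -[].
- rewrite integral0_eq// => q _; rewrite /F patchE ifN//.
  by apply: contra nAp; rewrite !inE => -[].
Qed.

Let FA q : (\int[leb3 R]_p F (p, q) = ((fun q =>
  (integral3 A (fun x => g (x, vec3 q)))%:E) \_ (@vec3 R @^-1` B)) q)%E.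
Proof.
rewrite patchE; case: ifPn => [/set_mem Bq|nBq].
- rewrite integral3E /Rintegral fineK; last first.
    by apply: integrable_fin_num (iA Bq) => //.
  rewrite [RHS]integral_mkcond; apply: eq_integral => p _.
  rewrite /F !patchE; congr (if _ then _ else _).
  by apply/idP/idP; rewrite !inE => // -[].
- rewrite integral0_eq// => p _; rewrite /F patchE ifN//.
  by apply: contra nBq; rewrite !inE => -[].
Qed.

Lemma integrable3_iterated :
  integrable3 A (fun x => integral3 B (fun v => g (x, v))).
Proof.
apply/(integrable_mkcond _ mA).
rewrite -(funext FB); exact: integrable_fubini_F iF.
Qed.

Lemma integral3_swap :
  integral3 A (fun x => integral3 B (fun v => g (x, v))) =
  integral3 B (fun v => integral3 A (fun x => g (x, v))).
Proof.
rewrite [LHS]integral3E [RHS]integral3E /Rintegral.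
rewrite [in LHS]integral_mkcond [in RHS]integral_mkcond.
by rewrite -(funext FA) -(funext FB) (Fubini iF).
Qed.

End iterated.

(** * Functions of class C^1 up to the boundary *)

Section derive_along.
Variables (R : realType) (V V' W : normedModType R) (f : V -> W) (g : V' -> W).
Variables (p w : V) (p' w' : V').
Hypothesis fg : forall h : R, f (h *: w + p) = g (h *: w' + p').

Let quotientE : (fun h : R => h^-1 *: (f (h *: w + p) - f p)) =
  (fun h : R => h^-1 *: (g (h *: w' + p') - g p')).
Proof.
by apply/funext => h; rewrite fg; have := fg 0; rewrite !scale0r !add0r => ->.
Qed.

(** A difference quotient sees only the values along one line, so functions on different spaces can
    be compared. This serves for slices of functions of two variables and for restrictions to
    axis-parallel lines. *)
Lemma derive_along : 'D_w f p = 'D_w' g p'.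
Proof. by rewrite /derive /= quotientE. Qed.

Lemma derivable_along : derivable f p w -> derivable g p' w'.
Proof. by rewrite /derivable /= quotientE. Qed.

End derive_along.

Section C1_algebra.
Variables (R : realType) (W : normedModType R) (U : set W).
Implicit Types f g : W -> R.

Lemma C1_closure_cst (Z : normedModType R) (c : Z) :
  C1_closure U (fun _ : W => c).
Proof.
split=> [|p _|w]; first exact: cst_continuous.
  exact: differentiable_cst.
exists (fun _ => 0); first exact: cst_continuous.
by move=> p _; rewrite derive_cst.
Qed.

Lemma C1_closureD (Z : normedModType R) (f g : W -> Z) :
  C1_closure U f -> C1_closure U g -> C1_closure U (fun p => f p + g p).
Proof.
move=> [cf df Df] [cg dg Dg]; split=> [x|p Up|w].
- exact: cvgD (cf x) (cg x).
- by apply: differentiableD; [exact: df|exact: dg].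
- have [F cF FE] := Df w; have [G cG GE] := Dg w.
  exists (fun p => F p + G p); first by move=> x; exact: cvgD (cF x) (cG x).
  move=> p Up; rewrite deriveD ?FE ?GE//; apply: diff_derivable; [exact: df|exact: dg].
Qed.

Lemma C1_closureZ (Z : normedModType R) (c : R) (f : W -> Z) :
  C1_closure U f -> C1_closure U (fun p => c *: f p).
Proof.
move=> [cf df Df]; split=> [x|p Up|w].
- exact: cvgZr (cf x).
- by apply: differentiableZ; exact: df.
- have [F cF FE] := Df w.
  exists (fun p => c *: F p); first by move=> x; exact: cvgZr (cF x).
  by move=> p Up; rewrite deriveZ ?FE//; apply: diff_derivable; exact: df.
Qed.

Lemma C1_closureM f g :
  C1_closure U f -> C1_closure U g -> C1_closure U (fun p => f p * g p).
Proof.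
move=> [cf df Df] [cg dg Dg]; split=> [x|p Up|w].
- exact: cvgM (cf x) (cg x).
- by apply: differentiableM; [exact: df|exact: dg].
- have [F cF FE] := Df w; have [G cG GE] := Dg w.
  exists (fun p => f p * G p + g p * F p).
    by move=> x; apply: cvgD; [exact: cvgM (cf x) (cG x)|exact: cvgM (cg x) (cF x)].
  move=> p Up; rewrite deriveM ?FE ?GE//; apply: diff_derivable; [exact: df|exact: dg].
Qed.

End C1_algebra.

Lemma C1_closure_coord (R : realType) (W : normedModType R) (U : set W)
    (F : W -> 'rV[R]_3) (i : 'I_3) :
  C1_closure U F -> C1_closure U (fun p => F p 0 i).
Proof.
move=> [cF dF DF]; split=> [x|p Up|w].
- exact: (@cvg_comp _ _ _ F (fun v : 'rV[R]_3 => v 0 i) _ _ _ (cF x)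
    (@coord_continuous _ _ _ 0 i _)).
- apply: (@differentiable_comp _ _ _ _ F (fun v : 'rV[R]_3 => v 0 i)).
    exact: dF.
  exact: differentiable_coord.
- have [G cG GE] := DF w; exists (fun p => G p 0 i).
    move=> x; exact: (@cvg_comp _ _ _ G (fun v : 'rV[R]_3 => v 0 i) _ _ _ (cG x)
      (@coord_continuous _ _ _ 0 i _)).
  move=> p Up; rewrite -GE// derive_mx ?mxE//.
  by apply: diff_derivable; exact: dF.
Qed.

Lemma C1_closure_id (R : realType) (U : set 'rV[R]_3) :
  C1_closure U (fun v : 'rV[R]_3 => v).
Proof.
split=> [|p _|w]; first by apply: continuous_subspaceT => x; exact: cvg_id.
  exact: ex_diff.
exists (fun _ => w); first exact: cst_continuous.
by move=> p _; rewrite derive_id.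
Qed.

Section C1_slices.
Variables (R : realType) (V : normedModType R) (Ov : set V) (f : V -> V -> R).
Hypothesis f1 : C1_closure (setT `*` Ov) (fun p : V * V => f p.1 p.2).

(** The derivative of the slice along [w] is the joint derivative along [(0, w)], and the continuous
    extension of the latter restricts to the slice. *)
Lemma C1_closure_slice2 (x : V) : C1_closure Ov (f x).
Proof.
have xcl v : closure Ov v -> closure (setT `*` Ov) (x, v).
  by move=> Ov_v; apply: closure_setX_subset; split=> //; exact: subset_closure.
have [cf df Df] := f1; split=> [|v Ov_v|w].
- exact: (within_continuous_comp (@pair_continuousr _ _ x) xcl cf).
- apply: (@differentiable_comp _ _ _ _ (fun v : V => (x, v)) (fun p : V * V => f p.1 p.2)).
    exact: (differentiable_pair (differentiable_cst _ _) ex_diff).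
  exact: df.
- have [G cG GE] := Df (0, w); exists (fun v => G (x, v)).
    exact: (within_continuous_comp (@pair_continuousr _ _ x) xcl cG).
  move=> v Ov_v; rewrite -GE//; apply: derive_along => h /=.
  by rewrite scaler0 add0r.
Qed.

(** Here [v] is in [Ov] and not merely in its closure, since joint differentiability is given on
    [setT] times [Ov]. *)
Lemma C1_closure_slice1 (v : V) : Ov v -> C1_closure setT (fun x => f x v).
Proof.
move=> Ov_v.
have vcl (x : V) : closure [set: V] x -> closure (setT `*` Ov) (x, v).
  by move=> clx; apply: closure_setX_subset; split=> //=; exact: subset_closure.
have [cf df Df] := f1; split=> [|x _|w].
- exact: (within_continuous_comp (@pair_continuousl V V v) vcl cf).
- apply: (@differentiable_comp _ _ _ _ (fun x : V => (x, v)) (fun p : V * V => f p.1 p.2)).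
    exact: (differentiable_pair ex_diff (differentiable_cst _ _)).
  exact: df.
- have [G cG GE] := Df (w, 0); exists (fun x => G (x, v)).
    exact: (within_continuous_comp (@pair_continuousl V V v) vcl cG).
  move=> x _; rewrite -GE//; apply: derive_along => h /=.
  by rewrite scaler0 add0r.
Qed.

End C1_slices.

(** * Integrals of partial derivatives *)

Lemma eq_integral3 (R : realType) (A : set 'rV[R]_3) (f g : 'rV[R]_3 -> R) :
  (forall v, A v -> f v = g v) -> integral3 A f = integral3 A g.
Proof.
by move=> fg; rewrite !integral3E; apply: eq_Rintegral => p /[!inE]; exact: fg.
Qed.

Lemma eq_integrable3 (R : realType) (A : set 'rV[R]_3) (f g : 'rV[R]_3 -> R) :
  measurable (@vec3 R @^-1` A) ->
  (forall v, A v -> f v = g v) -> integrable3 A f -> integrable3 A g.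
Proof.
move=> mA fg; apply: eq_integrable => // p /[!inE] Ap.
by rewrite (fg _ Ap).
Qed.

Lemma integral3D (R : realType) (A : set 'rV[R]_3) (f g : 'rV[R]_3 -> R) :
  measurable (@vec3 R @^-1` A) -> integrable3 A f -> integrable3 A g ->
  integral3 A (fun v => f v + g v) = integral3 A f + integral3 A g.
Proof. by move=> mA iF iG; rewrite !integral3E -RintegralD. Qed.

Lemma integrable3D (R : realType) (A : set 'rV[R]_3) (f g : 'rV[R]_3 -> R) :
  measurable (@vec3 R @^-1` A) -> integrable3 A f -> integrable3 A g ->
  integrable3 A (fun v => f v + g v).
Proof.
move=> mA iF iG; have := integrableD mA iF iG.
by apply: eq_integrable => // p _; rewrite EFinD.
Qed.

Lemma integral3Z (R : realType) (A : set 'rV[R]_3) (c : R) (f : 'rV[R]_3 -> R) :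
  measurable (@vec3 R @^-1` A) -> integrable3 A f ->
  integral3 A (fun v => c * f v) = c * integral3 A f.
Proof. by move=> mA iF; rewrite !integral3E -RintegralZl. Qed.

Lemma integrable3Z (R : realType) (A : set 'rV[R]_3) (c : R) (f : 'rV[R]_3 -> R) :
  measurable (@vec3 R @^-1` A) -> integrable3 A f ->
  integrable3 A (fun v => c * f v).
Proof.
move=> mA iF; have := integrableZl mA c iF.
by apply: eq_integrable => // p _; rewrite EFinM.
Qed.

Lemma integrable3_sum (R : realType) (A : set 'rV[R]_3)
    (f : 'I_3 -> 'rV[R]_3 -> R) :
  measurable (@vec3 R @^-1` A) -> (forall i, integrable3 A (f i)) ->
  integrable3 A (fun v => \sum_i f i v).
Proof.
move=> mA iF; apply: (eq_integrable3 (f := fun v => f 0 v + (f 1 v + f 2 v))) => //.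
  by move=> v _; rewrite !big_ord_recl big_ord0 addr0; do 2 congr (_ + _);
    congr (f _ v); exact/val_inj.
by do 2 (apply: integrable3D => //).
Qed.

Lemma integral3_sum (R : realType) (A : set 'rV[R]_3)
    (f : 'I_3 -> 'rV[R]_3 -> R) :
  measurable (@vec3 R @^-1` A) -> (forall i, integrable3 A (f i)) ->
  integral3 A (fun v => \sum_i f i v) = \sum_i integral3 A (f i).
Proof.
move=> mA iF.
have sumE (h : 'I_3 -> R) : \sum_i h i = h 0 + (h 1 + h 2).
  rewrite !big_ord_recl big_ord0 addr0; do 2 congr (_ + _);
    by congr (h _); exact/val_inj.
rewrite sumE -!integral3D//; last exact: integrable3D.
by apply: eq_integral3 => v _; rewrite sumE.
Qed.

Section line_calculus.
Variable R : realType.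
Implicit Types (i : 'I_3) (v : 'rV[R]_3) (u : R).

Lemma line_shift i v h u : line i v (h + u) = h *: unit_vec i + line i v u.
Proof.
apply/rowP => j; rewrite !mxE eqxx/= [j == i]eq_sym.
by case: eqP => _; rewrite ?mulr1 ?mulr0 ?add0r.
Qed.

Lemma line_continuous i v : continuous (line i v).
Proof.
move=> u; apply/cvg_ballP => e e0; near=> x.
split=> // k j; rewrite !mxE; case: ifP => _; last exact: ballxx.
by near: x; have : x @[x --> u] --> u by []; move/cvg_ball; exact.
Unshelve. all: by end_near. Qed.

Lemma line_bounded i v (A : set 'rV[R]_3) :
  bounded_set A -> bounded_set (line i v @^-1` A).
Proof.
move=> /pinfty_ex_gt0[M M0 AM]; exists M; split; rewrite ?num_real// => x Mx u /=.
move=> /AM uM; apply: le_trans (ltW Mx); apply: le_trans uM.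
by have := ler_coord_norm (line i v u) i; rewrite mxE eqxx.
Qed.

Lemma is_derive_line i v u (g : 'rV[R]_3 -> R) :
  differentiable g (line i v u) ->
  is_derive u 1 (g \o line i v) (partial i g (line i v u)).
Proof.
move=> dg.
have fg (h : R) : (g \o line i v) (h *: 1 + u) = g (h *: unit_vec i + line i v u).
  by rewrite /= -line_shift [h *: 1]mulr1.
split.
- by apply: (derivable_along (fun h => esym (fg h))); exact: diff_derivable.
- exact: derive_along.
Qed.

End line_calculus.

Section integral3_partial.
Variable R : realType.
Implicit Types (A : set 'rV[R]_3) (g : 'rV[R]_3 -> R).

(** On [A] the partial derivative agrees with its extension, which is continuous on [closure U]. *)
Lemma integrable3_partial A U g i : bounded_set A ->
  measurable (@vec3 R @^-1` A) -> A `<=` U -> C1_closure U g ->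
  integrable3 A (partial i g).
Proof.
move=> bA mA AU [_ _ /(_ (unit_vec i))[G cG GE]].
apply: (@eq_integrable3 _ _ G) => // [v Av|]; first by rewrite -GE//; exact: AU.
apply: integrable3_within => //; apply: continuous_subspaceW cG.
exact: closure_subset.
Qed.

Lemma integral3_partial_open A g i : open A -> bounded_set A ->
  C1_closure A g -> (forall v, (closure A `\` A) v -> g v = 0) ->
  integral3 A (partial i g) = 0.
Proof.
move=> oA bA g1 g0.
have mA : measurable (@vec3 R @^-1` A) by exact: borel_vec3.
apply: (integral3_slice (i := i)) => //.
  exact: (integrable3_partial i bA mA (@subset_refl _ A) g1).
case: g1 => [cg dg /(_ (unit_vec i))[G cG GE]] v.
(* The extension [G] replaces the derivative, since the fundamental theorem is applied up to the
   endpoints of the slices. *)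
transitivity (\int[lebesgue_measure]_(u in line i v @^-1` A)
    (G (line i v u))%:E)%E.
  by apply: eq_integral => u /[!inE]/= Au; rewrite -GE.
apply: (@open_FTC_vanish _ _ (line i v @^-1` closure A) (g \o line i v)).
- by apply: open_comp oA => u _; exact: line_continuous.
- exact: line_bounded.
- apply: preimage_closed; last exact: closed_closure.
  by move=> u _; exact: line_continuous.
- by move=> u /= Au; exact: subset_closure.
- exact: within_continuous_comp (@line_continuous _ i v) _ cg.
- exact: within_continuous_comp (@line_continuous _ i v) _ cG.
- move=> u Au; rewrite -GE//; apply: is_derive_line; exact: dg.
- by move=> u clu nAu; apply: g0.
Qed.

Lemma box_closed (a b : 'rV[R]_3) : closed (box a b).
Proof.
rewrite (_ : box a b = \bigcap_(i : 'I_3)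
    ((fun v : 'rV[R]_3 => v 0 i) @^-1` `[a 0 i, b 0 i]%classic)).
  apply: closed_bigI => i _; apply: preimage_closed; last exact: interval_closed.
  by move=> v _; exact: coord_continuous.
by apply/seteqP; split=> v vab i => [_|]; have := vab i; rewrite /= in_itv/=//; exact.
Qed.

Lemma box_bounded (a b : 'rV[R]_3) : bounded_set (box a b).
Proof.
exists (`|a| + `|b|); split; rewrite ?num_real// => x abx v vab /=.
apply: le_trans (ltW abx); rewrite [leLHS]/Num.Def.normr/= mx_normrE.
apply/bigmax_leP; split; first exact: addr_ge0.
move=> [k i] _ /=; rewrite ord1.
have ai := ler_coord_norm a i; have bi := ler_coord_norm b i.
have /andP[av vb] := vab i.
move: ai bi; rewrite !ler_norml => /andP[? ?] /andP[? ?].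
have := normr_ge0 a; have := normr_ge0 b => ? ?.
by apply/andP; split; lra.
Qed.

Lemma box_measurable (a b : 'rV[R]_3) : measurable (@vec3 R @^-1` box a b).
Proof. exact: borel_closed (@borel_vec3 R) (@box_closed a b). Qed.

(** Along direction [i] the slice of the box is one full period, and [g] takes equal values at its
    two ends. *)
Lemma integral3_partial_box (a b : 'rV[R]_3) g i : (forall j, a 0 j < b 0 j) ->
  C1_closure setT g -> box_periodic a b g -> integral3 (box a b) (partial i g) = 0.
Proof.
move=> ab g1 pg.
apply: (integral3_slice (i := i)); first exact: box_measurable.
  apply: (integrable3_partial i _ _ _ g1) => //; first exact: box_bounded.
  exact: box_measurable.
case: g1 => [cg dg /(_ (unit_vec i))[G cG GE]] v.
(* If another coordinate of [v] is out of range, the line misses the box; otherwise the slice is the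
   whole segment. *)
have [vab|nvab] := pselect (forall j, j != i -> a 0 j <= v 0 j <= b 0 j); last first.
  rewrite (_ : _ @^-1` _ = set0) ?integral_set0// -subset0 => u /= uab.
  by apply: nvab => j ji; have := uab j; rewrite !mxE (negbTE ji).
rewrite (_ : _ @^-1` _ = `[a 0 i, b 0 i]%classic); last first.
  apply/seteqP; split=> u; rewrite /= in_itv/=.
    by move=> /(_ i); rewrite !mxE eqxx.
  by move=> uab j; rewrite !mxE; case: ifP => [/eqP-> //|/negbT/vab].
transitivity (\int[lebesgue_measure]_(u in `[(a 0 i)%R, (b 0 i)%R]%classic)
    (G (line i v u))%:E)%E.
  by apply: eq_integral => u _; rewrite -GE.
apply: (@FTC_vanish _ (g \o line i v)) => //.
- apply: within_continuous_comp (@line_continuous _ i v) _ cg => u _.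
  exact: subset_closure.
- apply: within_continuous_comp (@line_continuous _ i v) _ cG => u _.
  exact: subset_closure.
- by move=> u _; rewrite -GE//; apply: is_derive_line; exact: dg.
- rewrite -[b 0 i](subrK (a 0 i)) /= line_shift addrC.
  by rewrite pg.
Qed.

End integral3_partial.

(** * Vector calculus *)

Section vector_calculus.
Variable R : realType.
Implicit Types (u v w p : 'rV[R]_3) (U : set 'rV[R]_3) (f g : 'rV[R]_3 -> R).

Lemma ord3P (i : 'I_3) : [\/ i = 0, i = 1 | i = 2].
Proof.
by case: i => -[|[|[|//]]] ilt; [constructor 1|constructor 2|constructor 3];
  exact/val_inj.
Qed.

Lemma big_ord3 (F : 'I_3 -> R) : \sum_i F i = F 0 + F 1 + F 2.
Proof.
rewrite !big_ord_recl big_ord0 addr0 addrA.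
by congr (_ + F _ + F _); exact/val_inj.
Qed.

Lemma dotE u v : dot u v = u 0 0 * v 0 0 + u 0 1 * v 0 1 + u 0 2 * v 0 2.
Proof. exact: big_ord3. Qed.

Lemma cross0E u w : cross u w 0 0 = u 0 1 * w 0 2 - u 0 2 * w 0 1.
Proof. by rewrite mxE. Qed.

Lemma cross1E u w : cross u w 0 1 = u 0 2 * w 0 0 - u 0 0 * w 0 2.
Proof. by rewrite mxE. Qed.

Lemma cross2E u w : cross u w 0 2 = u 0 0 * w 0 1 - u 0 1 * w 0 0.
Proof. by rewrite mxE. Qed.

Definition crossE := (cross0E, cross1E, cross2E).

Lemma partialD i f g p : differentiable f p -> differentiable g p ->
  partial i (fun x => f x + g x) p = partial i f p + partial i g p.
Proof. by move=> df dg; apply: deriveD; exact: diff_derivable. Qed.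

Lemma partialM i f g p : differentiable f p -> differentiable g p ->
  partial i (fun x => f x * g x) p = f p * partial i g p + g p * partial i f p.
Proof. by move=> df dg; apply: deriveM; exact: diff_derivable. Qed.

Lemma partial_cst i (c : R) p : partial i (fun _ => c) p = 0.
Proof. exact: derive_cst. Qed.

Lemma partial_indep i f p : (forall h, f (h *: unit_vec i + p) = f p) ->
  partial i f p = 0.
Proof.
move=> fp; rewrite -(partial_cst i (f p) p).
by apply: derive_along => h; rewrite fp.
Qed.

Lemma partial_coord i j p : partial i (fun v => v 0 j) p = (i == j)%:R.
Proof.
have := @derive_mx _ _ _ _ (fun v : 'rV[R]_3 => v) p (unit_vec i) _.
rewrite derive_id => /(_ (@derivable_id _ _ _ _)).
move/matrixP => /(_ 0 j); rewrite !mxE eqxx/= /partial => <-.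
by rewrite eq_sym.
Qed.

Lemma C1_closure_proj U i : C1_closure U (fun v => v 0 i).
Proof. exact: C1_closure_coord (C1_closure_id U). Qed.

Lemma C1_closure_dot U (F G : 'rV[R]_3 -> 'rV[R]_3) :
  C1_closure U F -> C1_closure U G -> C1_closure U (fun v => dot (F v) (G v)).
Proof.
move=> F1 G1; under eq_fun do rewrite dotE.
by do !apply: C1_closureD; apply: C1_closureM; exact: C1_closure_coord.
Qed.

Lemma C1_closureB U f g :
  C1_closure U f -> C1_closure U g -> C1_closure U (fun v => f v - g v).
Proof.
move=> f1 g1; under eq_fun do rewrite -mulN1r.
by apply: C1_closureD => //; apply: C1_closureM => //; exact: C1_closure_cst.
Qed.

Lemma C1_closure_cross U (F G : 'rV[R]_3 -> 'rV[R]_3) i :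
  C1_closure U F -> C1_closure U G -> C1_closure U (fun v => cross (F v) (G v) 0 i).
Proof.
move=> F1 G1; under eq_fun do rewrite mxE.
by have [->|->|->] := ord3P i; rewrite /=;
  apply: C1_closureB; apply: C1_closureM; exact: C1_closure_coord.
Qed.

Lemma C1_differentiable U f p : C1_closure U f -> U p -> differentiable f p.
Proof. by case=> _ df _; exact: df. Qed.

Lemma partial_dot i p : partial i (fun v => dot v v) p = 2 * p 0 i.
Proof.
have d j : differentiable (fun v => v 0 j : R) p.
  exact: (C1_differentiable (C1_closure_proj setT j)).
have -> : (fun v => dot v v) =
    (fun v => v 0 0 * v 0 0 + v 0 1 * v 0 1 + v 0 2 * v 0 2).
  by apply/funext => v; rewrite dotE.
rewrite !partialD ?partialM ?partial_coord//; last 4 first.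
- exact: differentiableM.
- exact: differentiableM.
- by apply: differentiableD; exact: differentiableM.
- exact: differentiableM.
by have [->|->|->] := ord3P i; rewrite /=; ring.
Qed.

(** The identity behind Poynting's theorem: it turns the two curl terms of the Maxwell equations
    into one divergence. *)
Lemma div_cross U (F G : 'rV[R]_3 -> 'rV[R]_3) p :
  C1_closure U F -> C1_closure U G -> U p ->
  \sum_i partial i (fun y => cross (F y) (G y) 0 i) p =
  dot (curl F p) (G p) - dot (F p) (curl G p).
Proof.
move=> F1 G1 Up.
have dF j : differentiable (fun y => F y 0 j) p.
  exact: (C1_differentiable (C1_closure_coord j F1)).
have dG j : differentiable (fun y => G y 0 j) p.
  exact: (C1_differentiable (C1_closure_coord j G1)).
have pB i j k l m : partial i (fun y => F y 0 j * G y 0 k - F y 0 l * G y 0 m) p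
    = F p 0 j * partial i (fun y => G y 0 k) p
      + G p 0 k * partial i (fun y => F y 0 j) p
      - (F p 0 l * partial i (fun y => G y 0 m) p
      + G p 0 m * partial i (fun y => F y 0 l) p).
  rewrite -partialM// -(partialM _ (dF l))//.
  by apply: deriveB; apply: diff_derivable; exact: differentiableM.
rewrite big_ord3.
under eq_fun do rewrite cross0E.
under [X in partial 1 X]eq_fun do rewrite cross1E.
under [X in partial 2 X]eq_fun do rewrite cross2E.
rewrite !pB !dotE /curl !mxE /=; ring.
Qed.

End vector_calculus.

(** * Kinetic energy *)

Section kinetic.
Variables (R : realType) (Ov : set 'rV[R]_3).
Hypotheses (oOv : open Ov) (bOv : bounded_set Ov).
Implicit Types f : 'rV[R]_3 -> R.

Let mOv : measurable (@vec3 R @^-1` Ov).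
Proof. exact: borel_vec3. Qed.

Let iC1 f : C1_closure Ov f -> integrable3 Ov f.
Proof. by case=> cf _ _; exact: integrable3_within. Qed.

(* The force [e + v x b] has divergence 0 in [v] and [b] does no work, so that
   div (|v|^2 (e + v x b) f) = |v|^2 (e + v x b) . grad f + 2 (v . e) f. *)
Lemma integral3_force f (e b : 'rV[R]_3) : C1_closure Ov f ->
  (forall v, (closure Ov `\` Ov) v -> f v = 0) ->
  let h v := dot v v * dot (e + cross v b) (grad f v) + 2 * (dot v e * f v) in
  integrable3 Ov h /\ integral3 Ov h = 0.
Proof.
move=> f1 f0 h.
pose q i (v : 'rV[R]_3) := dot v v * (e + cross v b) 0 i.
have a1 i : C1_closure Ov (fun v => (e + cross v b) 0 i).
  under eq_fun do rewrite mxE.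
  apply: C1_closureD; first exact: C1_closure_cst.
  by apply: C1_closure_cross; [exact: C1_closure_id|exact: C1_closure_cst].
have d1 : C1_closure Ov (fun v => dot v v).
  by apply: C1_closure_dot; exact: C1_closure_id.
have q1 i : C1_closure Ov (q i) by exact: C1_closureM.
have qf1 i : C1_closure Ov (fun v => q i v * f v) by exact: C1_closureM.
have hE v : Ov v -> \sum_i partial i (fun v => q i v * f v) v = h v.
  move=> Ov_v.
  have df : differentiable f v by exact: (C1_differentiable f1).
  have da i : differentiable (fun v => (e + cross v b) 0 i) v.
    exact: (C1_differentiable (a1 i)).
  have dd : differentiable (fun v => dot v v : R) v.
    exact: (C1_differentiable d1).
  under eq_bigr => i _.
    rewrite partialM//; last exact: (C1_differentiable (q1 i)).
    (* Component i of v x b does not involve the i-th coordinate of v, so each term of the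
       divergence of the force vanishes separately. *)
    rewrite partialM// (partial_indep (f := fun v => (e + cross v b) 0 i)).
      rewrite partial_dot; over.
    move=> k; rewrite !mxE.
    by have [->|->|->] := ord3P i; rewrite /= ?mxE /=; ring.
  have aE i : (e + cross v b) 0 i = e 0 i + cross v b 0 i by rewrite mxE.
  have gE i : grad f v 0 i = partial i f v by rewrite mxE.
  (* The gradient of |v|^2 contributes 2 v . (e + v x b) f, and v . (v x b) = 0 is a polynomial
     identity. *)
  rewrite /h big_ord3 /q !dotE !aE !gE !crossE; ring.
split.
  apply: (eq_integrable3 mOv hE); apply: integrable3_sum => // i.
  exact: (integrable3_partial i bOv mOv (@subset_refl _ Ov) (qf1 i)).
rewrite -(eq_integral3 hE) integral3_sum//.
  rewrite big1// => i _; apply: integral3_partial_open => //.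
  by move=> v /f0 ->; rewrite mulr0.
move=> i; exact: (integrable3_partial i bOv mOv (@subset_refl _ Ov) (qf1 i)).
Qed.

(** Multiplying the midpoint equation by |v|^2 and integrating leaves the work of [e] on the sum of
    the two currents. Scheme-b is the case [b = 0], Scheme-c the case [e = 0]. *)
Lemma kinetic_force (f g : 'rV[R]_3 -> R) (tau : R) (e b : 'rV[R]_3) :
  tau != 0 -> C1_closure Ov f -> C1_closure Ov g ->
  (forall v, (closure Ov `\` Ov) v -> f v = 0) ->
  (forall v, (closure Ov `\` Ov) v -> g v = 0) ->
  (forall v, Ov v -> (g v - f v) / tau
    + dot (e + cross v b) (grad (fun w => (f w + g w) / 2) v) = 0) ->
  integral3 Ov (fun v => g v * dot v v) = integral3 Ov (fun v => f v * dot v v)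
    + tau * dot e ((\row_i integral3 Ov (fun v => f v * v 0 i))
                   + (\row_i integral3 Ov (fun v => g v * v 0 i))).
Proof.
move=> tau0 f1 g1 f0 g0 fg.
pose m w := (f w + g w) / 2.
have m1 : C1_closure Ov m.
  by apply: C1_closureM; [exact: C1_closureD|exact: C1_closure_cst].
have m0 v : (closure Ov `\` Ov) v -> m v = 0.
  by move=> bv; rewrite /m f0// g0// addr0 mul0r.
have [ih h0] := integral3_force e b m1 m0.
set h := (X in integral3 Ov X) in h0.
have ifd : integrable3 Ov (fun v => f v * dot v v).
  by apply: iC1; apply: C1_closureM => //; apply: C1_closure_dot; exact: C1_closure_id.
have im i : integrable3 Ov (fun v => e 0 i * (f v * v 0 i + g v * v 0 i)).
  apply: iC1; apply: C1_closureM; first exact: C1_closure_cst.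
  by apply: C1_closureD; apply: C1_closureM => //; exact: C1_closure_proj.
have imf i : integrable3 Ov (fun v => f v * v 0 i).
  by apply: iC1; apply: C1_closureM => //; exact: C1_closure_proj.
have img i : integrable3 Ov (fun v => g v * v 0 i).
  by apply: iC1; apply: C1_closureM => //; exact: C1_closure_proj.
have isum : integrable3 Ov (fun v => \sum_i e 0 i * (f v * v 0 i + g v * v 0 i)).
  exact: integrable3_sum.
(* Since 2 m = f + g, the work term in [h] is (v . e) (f + g); adding it back turns - tau h into the
   increment of g |v|^2 over f |v|^2. *)
transitivity (integral3 Ov (fun v => f v * dot v v + (- tau * h v +
    tau * \sum_i e 0 i * (f v * v 0 i + g v * v 0 i)))).
  apply: eq_integral3 => v Ov_v; rewrite /h; have := fg v Ov_v.
  rewrite -/m; set D := dot (e + _) _ => eD.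
  have -> : D = - ((g v - f v) / tau) by apply/eqP; rewrite -addr_eq0 addrC eD.
  rewrite big_ord3 !dotE /m; field.
  by rewrite ?tau0.
rewrite !integral3D// ?integral3Z//; [|exact: integrable3Z..|]; last first.
  by apply: integrable3D => //; exact: integrable3Z.
rewrite h0 mulr0 add0r; congr (_ + _ * _).
rewrite integral3_sum//; apply: eq_bigr => i _.
rewrite integral3Z//; last exact: integrable3D.
by rewrite integral3D// !mxE.
Qed.

End kinetic.

(** * The schemes *)

Section schemes.
Variables (R : realType) (a b : 'rV[R]_3) (Ov : set 'rV[R]_3).
Hypotheses (ab : forall i, a 0 i < b 0 i) (oOv : open Ov) (bOv : bounded_set Ov).
Implicit Types (s t : state a b Ov) (tau : R).

Let mOv : measurable (@vec3 R @^-1` Ov).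
Proof. exact: borel_vec3. Qed.

Let mbox := box_measurable a b.

Let dens_bdry s x v : (closure Ov `\` Ov) v -> dens s x v = 0.
Proof. by move=> bv; apply: dens_boundary; rewrite ((interior_id _).1 oOv). Qed.

Let dens1 s x : C1_closure Ov (dens s x).
Proof. exact: C1_closure_slice2 (dens_C1 s) x. Qed.

Let kinetic s x := integral3 Ov (fun v => dens s x v * dot v v).

Let field_energy s x :=
  dot (efield s x) (efield s x) + dot (bfield s x) (bfield s x).

Let within_kinetic s : {within closure (box a b) `*` closure Ov,
  continuous (fun p : 'rV[R]_3 * 'rV[R]_3 => dens s p.1 p.2 * dot p.2 p.2)}.
Proof.
have [cd _ _] := dens_C1 s.
have cd' : {within closure (box a b) `*` closure Ov,
    continuous (fun p : 'rV[R]_3 * 'rV[R]_3 => dens s p.1 p.2)}.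
  apply: continuous_subspaceW cd => -[x v] [/= _ Ov_v].
  by apply: closure_setX_subset; split=> //; exact: subset_closure.
have [cdot _ _] : C1_closure setT (fun v : 'rV[R]_3 => dot v v).
  by apply: C1_closure_dot; exact: C1_closure_id.
have cd2 : {within closure (box a b) `*` closure Ov,
    continuous (fun p : 'rV[R]_3 * 'rV[R]_3 => dot p.2 p.2)}.
  apply: (within_continuous_comp (f := @snd _ _) _ _ cdot).
    by move=> -[x v]; exact: cvg_snd.
  by move=> p _; exact: subset_closure.
by move=> p; exact: cvgM (cd' p) (cd2 p).
Qed.

(** Fubini gives integrability in x of the inner integral, the integrand being continuous on the
    product of the closures. *)
Let ikinetic s : integrable3 (box a b) (kinetic s).
Proof.
exact: (integrable3_iterated (@box_bounded _ a b) bOv mbox mOv (@within_kinetic s)).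
Qed.

Let ifield s : integrable3 (box a b) (field_energy s).
Proof.
have : C1_closure setT (field_energy s).
  apply: C1_closureD; apply: C1_closure_dot;
    by [exact: efield_C1|exact: bfield_C1].
case=> cf _ _; apply: integrable3_within => //; first exact: box_bounded.
by apply: continuous_subspaceW cf => x _; exact: subset_closure.
Qed.

Let total_energyE s : total_energy s =
  2^-1 * (integral3 (box a b) (kinetic s) + integral3 (box a b) (field_energy s)).
Proof. by []. Qed.

Let kinetic_swap s : integral3 (box a b) (kinetic s) =
  integral3 Ov (fun v => integral3 (box a b) (fun x => dens s x v * dot v v)).
Proof.
exact: (integral3_swap (@box_bounded _ a b) bOv mbox mOv (@within_kinetic s)).
Qed.

Lemma scheme_a_energy tau s t : tau != 0 -> scheme_a tau (s, t) ->
  total_energy s = total_energy t.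
Proof.
move=> tau0 [st Est Bst]; rewrite !total_energyE.
have -> : field_energy t = field_energy s by rewrite /field_energy Est Bst.
suff -> : integral3 (box a b) (kinetic s) = integral3 (box a b) (kinetic t) by [].
(* With x as the inner variable, v and |v|^2 are constants, and the transport term is a combination
   of x-derivatives of the periodic function [m]. *)
rewrite !kinetic_swap; apply: eq_integral3 => v Ov_v.
pose m y := (dens s y v + dens t y v) / 2.
have s1 := C1_closure_slice1 (dens_C1 s) Ov_v.
have t1 := C1_closure_slice1 (dens_C1 t) Ov_v.
have m1 : C1_closure setT m.
  by apply: C1_closureM; [exact: C1_closureD|exact: C1_closure_cst].
have mper : box_periodic a b m.
  move=> i x; rewrite /m.
  have clv : closure Ov v by exact: subset_closure.
  by rewrite (dens_periodic s clv) (dens_periodic t clv).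
have im i : integrable3 (box a b) (partial i m).
  by apply: (integrable3_partial i _ _ _ m1) => //; exact: box_bounded.
have icm i : integrable3 (box a b)
    (fun x => - tau * dot v v * v 0 i * partial i m x).
  exact: integrable3Z.
have is_ : integrable3 (box a b) (fun x => dens s x v * dot v v).
  have [cf _ _] : C1_closure setT (fun x => dens s x v * dot v v).
    by apply: C1_closureM => //; exact: C1_closure_cst.
  apply: integrable3_within => //; first exact: box_bounded.
  by apply: continuous_subspaceW cf => x _; exact: subset_closure.
transitivity (integral3 (box a b) (fun x => dens s x v * dot v v +
    \sum_i - tau * dot v v * v 0 i * partial i m x)).
  rewrite integral3D//; last exact: integrable3_sum.
  rewrite integral3_sum// big1 ?addr0// => i _.
  by rewrite integral3Z// integral3_partial_box// mulr0.
apply: eq_integral3 => x _; have := st x v Ov_v.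
rewrite -/(m) /gradx_mid big_ord3 dotE !mxE -/m.
set p0 := partial 0 _ _; set p1 := partial 1 _ _; set p2 := partial 2 _ _ => eqn.
have -> : dens t x v = dens s x v + tau * ((dens t x v - dens s x v) / tau).
  by field.
have -> : (dens t x v - dens s x v) / tau =
    - (v 0 0 * p0 + v 0 1 * p1 + v 0 2 * p2).
  by apply/eqP; rewrite -addr_eq0 eqn.
ring.
Qed.

(** Both energies stand under one integral because Scheme-b exchanges them pointwise in x. *)
Let total_energyD s : total_energy s =
  2^-1 * integral3 (box a b) (fun x => kinetic s x + field_energy s x).
Proof. by rewrite integral3D. Qed.

Let cross0r (v : 'rV[R]_3) : cross v 0 = 0.
Proof.
by apply/rowP => j; have [->|->|->] := ord3P j; rewrite crossE !mxE /= ?mxE; ring.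
Qed.

Let crossZr c (u w : 'rV[R]_3) : cross u (c *: w) = c *: cross u w.
Proof.
apply/rowP => j; rewrite [RHS]mxE.
by have [->|->|->] := ord3P j; rewrite !crossE ![(c *: w) 0 _]mxE; ring.
Qed.

Let dotZl c (u w : 'rV[R]_3) : dot (c *: u) w = c * dot u w.
Proof. by rewrite !dotE ![(c *: u) 0 _]mxE; ring. Qed.

Let dotZr c (u w : 'rV[R]_3) : dot u (c *: w) = c * dot u w.
Proof. by rewrite !dotE ![(c *: w) 0 _]mxE; ring. Qed.

Let dotC (u w : 'rV[R]_3) : dot u w = dot w u.
Proof. by rewrite !dotE; ring. Qed.

(** This is why midpoint averages conserve quadratic energies exactly. *)
Let dot_sub_add (x y : 'rV[R]_3) : dot (x + y) (y - x) = dot y y - dot x x.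
Proof. by rewrite !dotE ![(x + y) 0 _]mxE ![(y - x) 0 _]mxE ![(- x) 0 _]mxE; ring. Qed.

Lemma scheme_b_energy tau s t : tau != 0 -> scheme_b tau (s, t) ->
  total_energy s = total_energy t.
Proof.
move=> tau0 [fst Est Bst]; rewrite !total_energyD; apply: (congr1 (fun z => 2^-1 * z)).
apply: eq_integral3 => x _; rewrite /field_energy Bst.
have -> : kinetic t x = kinetic s x + tau *
    dot (2^-1 *: (efield s x + efield t x)) (current s x + current t x).
  apply: (kinetic_force oOv bOv (b := 0)) => //.
  - by move=> v; exact: dens_bdry.
  - by move=> v; exact: dens_bdry.
  - by move=> v Ov_v; rewrite cross0r addr0; exact: fst.
(* The Ampere equation solved for the currents: the work becomes minus the increment of |E|^2. *)
have -> : current s x + current t x =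
    (- 2 / tau) *: (efield t x - efield s x).
  apply/rowP => j; have := congr1 (fun w : 'rV[R]_3 => w 0 j) (Est x).
  by rewrite !mxE -mulrA => ->; field.
rewrite dotZl dotZr dot_sub_add; field.
by rewrite ?tau0.
Qed.

Lemma scheme_c_energy tau s t : tau != 0 -> scheme_c tau (s, t) ->
  total_energy s = total_energy t.
Proof.
move=> tau0 [Bst Est fst]; rewrite !total_energyE.
(* With no electric force the work term is zero, so the kinetic energy is kept at each x. *)
have -> : integral3 (box a b) (kinetic s) = integral3 (box a b) (kinetic t).
  apply: eq_integral3 => x _; apply/esym; rewrite [LHS]/kinetic.
  rewrite (kinetic_force oOv bOv (e := 0)
    (b := 2^-1 *: (bfield s x + bfield t x)) tau0 (dens1 s x) (dens1 t x)).
  - by rewrite dotE !mxE !mul0r !addr0 mulr0 addr0.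
  - by move=> v; exact: dens_bdry.
  - by move=> v; exact: dens_bdry.
  - move=> v Ov_v; rewrite add0r.
    rewrite crossZr; exact: fst.
pose E x := 2^-1 *: (efield s x + efield t x).
pose B x := 2^-1 *: (bfield s x + bfield t x).
have E1 : C1_closure setT E.
  by apply: C1_closureZ; apply: C1_closureD; exact: efield_C1.
have B1 : C1_closure setT B.
  by apply: C1_closureZ; apply: C1_closureD; exact: bfield_C1.
have EB1 i : C1_closure setT (fun x => cross (E x) (B x) 0 i).
  exact: C1_closure_cross.
have iEB i : integrable3 (box a b) (partial i (fun x => cross (E x) (B x) 0 i)).
  by apply: (integrable3_partial i _ _ _ (EB1 i)) => //; exact: box_bounded.
have EBper i : box_periodic a b (fun x => cross (E x) (B x) 0 i).
  by move=> j x; rewrite /E /B !efield_periodic !bfield_periodic.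
suff -> : integral3 (box a b) (field_energy t) =
    integral3 (box a b) (field_energy s) by [].
(* Both Maxwell equations give div (E x B) = - (increment of |E|^2 + |B|^2) / (2 tau) for the
   midpoint fields, whence the factor - 2 tau. *)
transitivity (integral3 (box a b) (fun x => field_energy s x +
    (- 2 * tau) * \sum_i partial i (fun x => cross (E x) (B x) 0 i) x)).
  apply: eq_integral3 => x _; rewrite (div_cross E1 B1)// /field_energy.
  have -> : curl E x = - tau^-1 *: (bfield t x - bfield s x).
    by rewrite scaleNr Bst opprK.
  have -> : curl B x = tau^-1 *: (efield t x - efield s x) by rewrite Est.
  rewrite [dot _ (B x)]dotC !dotZl !dotZr !dot_sub_add; field.
  by rewrite ?tau0.
rewrite integral3D//; last by apply: integrable3Z => //; exact: integrable3_sum.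
rewrite integral3Z//; last exact: integrable3_sum.
rewrite integral3_sum// big1 ?mulr0 ?addr0// => i _.
exact: integral3_partial_box.
Qed.

End schemes.

Theorem theorem2p2 (R : realType) (a b : 'rV[R]_3) (Ov : set 'rV[R]_3)
    (dt : R) (s t : state a b Ov) :
  (forall i, a 0 i < b 0 i) ->
  open Ov -> bounded_set Ov ->
  0 < dt ->
  scheme5 dt (s, t) ->
  total_energy s = total_energy t.
Proof.
move=> ab oOv bOv dt0.
have dt_neq0 : dt != 0 by rewrite gt_eqF.
have dt2_neq0 : dt / 2 != 0 by rewrite gt_eqF// divr_gt0.
move=> [s4 [s3 [s2 [s1 a1 b1] c1] b2] a2].
rewrite (scheme_a_energy ab oOv bOv dt2_neq0 a1).
rewrite (scheme_b_energy oOv bOv dt2_neq0 b1).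
rewrite (scheme_c_energy ab oOv bOv dt_neq0 c1).
rewrite (scheme_b_energy oOv bOv dt2_neq0 b2).
exact: scheme_a_energy dt2_neq0 a2.
Qed.
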